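(* Let $\varphi$ and $\psi$ be modal CNF formulas, let $\bar{\sigma}$ be a consistent permutation sequence, and let $\mathcal{C}$ be a class of models, closed under accessibility relations, which is closed under trees and such that $\mathcal{C}\cap\mathcal{C}_{\mathit{Tree}}$ is closed under $\bar{\sigma}$. If $\bar{\sigma}$ is a symmetry of $\varphi$, then for any $\psi$ we have $\varphi\models_{\mathcal{C}}\psi$ if and only if $\varphi\models_{\mathcal{C}}\bar{\sigma}(\psi)$.
   Context: Fix a modal signature $\langle \mathsf{Atom}, \mathsf{Mod}\rangle$ of two countable disjoint sets. A literal is $a$ or $\neg a$ with $a \in \mathsf{Atom}$; $\mathsf{ALit}$ is the set of literals, $\neg\neg a=a$. A modal CNF formula is a finite set of modal CNF clauses (read conjunctively); a modal CNF clause is a finite set (read disjunctively) of literals and modal literals; a modal literal is $[m]C$ or $\neg[m]C$ with $m\in\mathsf{Mod}$, $C$ a modal CNF clause. Some modalities may be indexed by an atom $a$ (written $m(a)$). Models (coinductive): for nonempty $W$, $\mathbf{Mods}_W$ is the coinductively defined class of tuples $\langle w,W,V,R\rangle$ with $w\in W$, $V(v)\subseteq\mathsf{Atom}$, $R(m,v)\subseteq\mathbf{Mods}_W$ for $m\in\mathsf{Mod}$, $v\in W$; $w^{\mathcal{M}}$ denotes the point $w$. $\mathrm{Ext}(\mathcal{M})$ is the smallest subset of $\mathbf{Mods}_W$ containing $\mathcal{M}$ and closed under $\mathcal{N}\mapsto R^{\mathcal{N}}(m,v)$. A class $\mathcal{C}$ is closed under accessibility relations if $\mathcal{M}\in\mathcal{C}$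 implies $\mathrm{Ext}(\mathcal{M})\subseteq\mathcal{C}$. Satisfaction: $\mathcal{M}\models\varphi$ iff $\mathcal{M}\models C$ for all $C\in\varphi$; $\mathcal{M}\models C$ iff some $\lambda\in C$ has $\mathcal{M}\models\lambda$; $\mathcal{M}\models a$ iff $a\in V(w)$; $\mathcal{M}\models\neg a$ iff $a\notin V(w)$; $\mathcal{M}\models[m]C$ iff $\mathcal{N}\models C$ for all $\mathcal{N}\in R(m,w)$; $\mathcal{M}\models\neg[m]C$ iff $\mathcal{M}\not\models[m]C$. $\mathrm{Mod}_{\mathcal{C}}(\varphi)=\{\mathcal{M}\in\mathcal{C}:\mathcal{M}\models\varphi\}$; $\varphi\models_{\mathcal{C}}\psi$ iff $\mathrm{Mod}_{\mathcal{C}}(\varphi)\subseteq\mathrm{Mod}_{\mathcal{C}}(\psi)$. Bisimulation: $\mathcal{M}$ and $\mathcal{M}'$ are bisimilar if $\mathcal{M}Z\mathcal{M}'$ for some $Z\subseteq\mathrm{Ext}(\mathcal{M})\times\mathrm{Ext}(\mathcal{M}')$ such that whenever $\langle w,W,V,R\rangle Z\langle w',W',V',R'\rangle$: $a\in V(w)$ iff $a\in V'(w')$ for all atoms $a$; every $\mathcal{N}\in R(m,w)$ has some $\mathcal{N}'\in R'(m,w')$ with $\mathcal{N}Z\mathcal{N}'$; every $\mathcal{N}'\in R'(m,w')$ has some $\mathcal{N}\in R(m,w)$ with $\mathcal{N}Z\mathcal{N}'$. Trees: a path rooted at $\mathcal{M}$ is a sequence $(\mathcal{M}_0,m_1,\mathcal{M}_1,\dots,m_k,\mathcal{M}_k)$,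 $k\ge0$, $\mathcal{M}_0=\mathcal{M}$, $m_i\in\mathsf{Mod}$, $\mathcal{M}_i\in R^{\mathcal{M}_{i-1}}(m_i,w^{\mathcal{M}_{i-1}})$; $\Pi[\mathcal{M}]$ is the set of such paths and $\mathit{last}$ returns the last model. $\mathcal{M}$ is a tree model ($\mathcal{M}\in\mathcal{C}_{\mathit{Tree}}$) iff $\mathit{last}:\Pi[\mathcal{M}]\to\mathrm{Ext}(\mathcal{M})$ is bijective. A class $\mathcal{C}$ is closed under trees if every $\mathcal{M}\in\mathcal{C}$ is bisimilar to some tree model $\mathcal{T}\in\mathcal{C}$. Permutations: bijections $\sigma:\mathsf{ALit}\to\mathsf{ALit}$ moving only finitely many literals; consistent if $\sigma(\neg l)=\neg\sigma(l)$. For a modality, $\sigma(m(a))=m(\sigma(a))$ if $m$ is indexed by atom $a$, else $\sigma(m)=m$. For $S\subseteq\mathsf{Atom}$, $L_S=S\cup\{\neg a:a\in\mathsf{Atom}\setminus S\}$. Permutation sequences: either the empty sequence $\langle\rangle$ or $\sigma:\bar{\sigma}_2$ with $\sigma$ a permutation and $\bar\sigma_2$ a permutation sequence; for $\bar\sigma=\langle\sigma_1,\dots,\sigma_n\rangle$, $\bar\sigma_i$ is the subsequence starting at the $i$-th element ($\bar\sigma_i=\langle\rangle$ for $i>n$), $\mathit{head}(\sigma_1:\bar\sigma_2)=\sigma_1$, $\mathit{head}(\langle\rangle)$ is the identity. $\bar\sigma$ is consistent if all its permutations are. Layered application to formulas: $\langle\rangle(\varphi)=\varphi$; $(\sigma_1:\bar\sigma_2)(l)=\sigma_1(l)$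 for literals $l$; $(\sigma_1:\bar\sigma_2)([m]C)=[\sigma_1(m)]\bar\sigma_2(C)$ and $(\sigma_1:\bar\sigma_2)(\neg[m]C)=\neg[\sigma_1(m)]\bar\sigma_2(C)$; on clauses and formulas, elementwise. $\bar\sigma$ is a symmetry of $\varphi$ if $\bar\sigma(\varphi)=\varphi$. Layered application to a tree model $\mathcal{M}=\langle w,W,V,R\rangle$: $\bar\sigma(\mathcal{M})=\langle w,W,V',R'\rangle$ with $V'(v)=\mathit{head}(\bar\sigma)(L_{V(v)})\cap\mathsf{Atom}$ and $R'(m,v)=\{\bar\sigma_2(\mathcal{N}):\mathcal{N}\in R(\mathit{head}(\bar\sigma)(m),v)\}$. A class $\mathcal{D}$ of tree models is closed under $\bar\sigma$ if $\bar\sigma(\mathcal{M})\in\mathcal{D}$ for all $\mathcal{M}\in\mathcal{D}$.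
   Formalization: In σ̄(M), R'(m,v) is taken from R at the inverse image head(σ̄)^{-1}(m) instead of head(σ̄)(m), since the claim fails otherwise for e.g. a 3-cycle of indices; and when σ(a)=¬b, where m(σ(a)) is undefined, σ(m(a)) is read as m(b). *)

(* Defs.v *)
From HB Require Import structures.
From mathcomp Require Import all_boot.
From mathcomp Require Import generic_quotient.
From mathcomp Require Import boolp classical_sets functions cardinality.
From Stdlib Require List.

Set Implicit Arguments.
Unset Strict Implicit.
Unset Printing Implicit Defensive.

Local Open Scope classical_set_scope.
Local Open Scope quotient_scope.

(* A modality is either plain or of the form m(a) with a an atom; countable
   types may be finite, so either sort of modality may be absent. *)
Record signature := Signature {
  Atom : countType;
  PlainMod : countType;
  IndexedMod : countType
}.

Inductive modality (S : signature) :=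
| Plain of PlainMod S
| At of IndexedMod S & Atom S.

Arguments Plain {S}.
Arguments At {S}.

Inductive lit (S : signature) :=
| Pos of Atom S
| Neg of Atom S.

Arguments Pos {S}.
Arguments Neg {S}.

Section Syntax.
Variable S : signature.

Definition negl (l : lit S) : lit S :=
  match l with Pos a => Neg a | Neg a => Pos a end.

Definition atom_of (l : lit S) : Atom S :=
  match l with Pos a => a | Neg a => a end.

(* Finite sets of (modal) literals and of clauses are represented by lists,
   compared with [clause_eq] and [formula_eq] below. *)
Inductive mlit :=
| Lit of lit S
| Box of modality S & seq mlit
| NBox of modality S & seq mlit.

Definition clause := seq mlit.
Definition formula := seq clause.

(* Prop-valued [all] and [has]; see [allPropP] and [hasPropP]. *)
Definition allProp T (P : T -> Prop) (s : seq T) : Prop :=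
  foldr (fun x Q => P x /\ Q) True s.
Definition hasProp T (P : T -> Prop) (s : seq T) : Prop :=
  foldr (fun x Q => P x \/ Q) False s.

Lemma allPropP T (P : T -> Prop) s :
  allProp P s <-> forall x, List.In x s -> P x.
Proof.
elim: s => [|y s IH] /=; first by split.
split=> [[Py /IH Ps] x [<-|/Ps]|H] //.
by split; [apply: H; left | apply/IH => x xs; apply: H; right].
Qed.

Lemma hasPropP T (P : T -> Prop) s :
  hasProp P s <-> exists2 x, List.In x s & P x.
Proof.
elim: s => [|y s IH] /=; first by split=> [|[]].
split=> [[Py|/IH[x xs Px]]|[x [<-|xs] Px]].
- by exists y => //; left.
- by exists x => //; right.
- by left.
- by right; apply/IH; exists x.
Qed.

(* The sets listed by s and t coincide, up to [r] on elements. *)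
Definition set_eq_by T (r : T -> T -> Prop) (s t : seq T) : Prop :=
  allProp (fun x => hasProp (fun y => r x y) t) s /\
  allProp (fun y => hasProp (fun x => r x y) s) t.

Fixpoint mlit_eq (x y : mlit) {struct x} : Prop :=
  match x, y with
  | Lit l, Lit l' => l = l'
  | Box m C, Box m' C' => m = m' /\ set_eq_by mlit_eq C C'
  | NBox m C, NBox m' C' => m = m' /\ set_eq_by mlit_eq C C'
  | _, _ => False
  end.

Definition clause_eq : clause -> clause -> Prop := set_eq_by mlit_eq.
Definition formula_eq : formula -> formula -> Prop := set_eq_by clause_eq.

Record lperm := LPerm {
  lperm_fun :> lit S -> lit S;
  lperm_inv : lit S -> lit S;
  lperm_funK : cancel lperm_fun lperm_inv;
  lperm_invK : cancel lperm_inv lperm_fun;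
  lperm_finite : finite_set [set l | lperm_fun l <> l]
}.

Fact lperm_id_finite : finite_set [set l : lit S | id l <> l].
Proof.
suff -> : [set l : lit S | id l <> l] = set0 by exact: finite_set0.
by apply/seteqP; split=> l //=; apply.
Qed.

Definition lperm_id : lperm :=
  @LPerm id id (fun=> erefl) (fun=> erefl) lperm_id_finite.

Definition consistent (s : lperm) : Prop := forall l, s (negl l) = negl (s l).

(* The image of m(a) is m(s a) when s a is an atom. When s a is the negation of
   an atom b, "m(s a)" is not a modality, and m(b) is used. *)
Definition act_mod (f : lit S -> lit S) (m : modality S) : modality S :=
  match m with
  | Plain k => Plain k
  | At k a => At k (atom_of (f (Pos a)))
  end.

Definition perm_seq := seq lperm.

Definition consistent_seq (ss : perm_seq) : Prop := List.Forall consistent ss.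

Definition phead (ss : perm_seq) : lperm := head lperm_id ss.

Fixpoint app_mlit (ss : perm_seq) (x : mlit) {struct x} : mlit :=
  match ss with
  | [::] => x
  | s :: ss2 =>
    match x with
    | Lit l => Lit (s l)
    | Box m C => Box (act_mod s m) (map (app_mlit ss2) C)
    | NBox m C => NBox (act_mod s m) (map (app_mlit ss2) C)
    end
  end.

Definition app_clause (ss : perm_seq) (C : clause) : clause :=
  map (app_mlit ss) C.

Definition app_formula (ss : perm_seq) (phi : formula) : formula :=
  map (app_clause ss) phi.

Definition is_symmetry (ss : perm_seq) (phi : formula) : Prop :=
  formula_eq (app_formula ss phi) phi.

End Syntax.

(* Models. The set R(m, v) of models is given as a small family indexed by
   [pix m v]. Coinductively defined tuples are equal as soon as they are related
   by a relation that preserves all components, R(m, v) being compared as a set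
   at every v of W (not only at the point): this is [pmeq], and the type
   [model S W] of models over W is the quotient by it, so that equality of
   models is Leibniz equality. *)
Set Primitive Projections.
CoInductive premodel (S : signature) (W : Type) := PreModel {
  ppt : W;
  pval : W -> set (Atom S);
  pix : modality S -> W -> Type;
  pnx : forall m v, pix m v -> premodel S W
}.
Unset Primitive Projections.

Arguments pnx {S W} _ {m v}.

Section Models.
Variables (S : signature) (W : Type).
Implicit Types M N : premodel S W.

Definition same_components (Z : premodel S W -> premodel S W -> Prop) : Prop :=
  forall M M', Z M M' ->
  [/\ ppt M = ppt M',
      (forall v, pval M v = pval M' v),
      (forall m v (i : pix M m v), exists j : pix M' m v, Z (pnx M i) (pnx M' j))
    & (forall m v (j : pix M' m v), exists i : pix M m v, Z (pnx M i) (pnx M' j))].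

Definition pmeq M M' : Prop := exists2 Z, same_components Z & Z M M'.

Lemma pmeq_refl M : pmeq M M.
Proof.
exists eq => // {}M _ <-; split=> // m v i; by exists i.
Qed.

Lemma pmeq_sym M M' : pmeq M M' -> pmeq M' M.
Proof.
case=> Z HZ ZMM'; exists (fun X Y => Z Y X) => // {ZMM'}M {}M' /HZ[e1 e2 f b].
by split=> // v; rewrite e2.
Qed.

Lemma pmeq_trans N M M' : pmeq M N -> pmeq N M' -> pmeq M M'.
Proof.
case=> Z HZ ZMN [Z' HZ' ZNM'].
exists (fun X Y => exists2 U, Z X U & Z' U Y); last by exists N.
move=> {ZMN ZNM'}M {}M' [U /HZ[e1 e2 f b] /HZ'[e1' e2' f' b']].
split; first by rewrite e1.
- by move=> v; rewrite e2.
- by move=> m v i; have [j] := f m v i; have [k] := f' m v j; exists k; exists (pnx U j).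
- by move=> m v i; have [j] := b' m v i; have [k] := b m v j; exists k; exists (pnx U j).
Qed.

Lemma pmeq_same : same_components pmeq.
Proof.
move=> M M' [Z HZ /HZ[e1 e2 f b]]; split=> // m v i.
- by have [j] := f m v i; exists j; exists Z.
- by have [j] := b m v i; exists j; exists Z.
Qed.

HB.instance Definition _ := gen_eqMixin (premodel S W).
HB.instance Definition _ := gen_choiceMixin (premodel S W).

Definition pmeqb : rel (premodel S W) := fun M N => `[< pmeq M N >].

Fact pmeqb_refl : reflexive pmeqb.
Proof. by move=> M; apply/asboolP; exact: pmeq_refl. Qed.
Fact pmeqb_sym : symmetric pmeqb.
Proof. by move=> M N; apply/asboolP/asboolP; exact: pmeq_sym. Qed.
Fact pmeqb_trans : transitive pmeqb.
Proof.
by move=> N M M' /asboolP MN /asboolP NM'; apply/asboolP; exact: pmeq_trans NM'.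
Qed.

Canonical pmeqb_equiv := EquivRel pmeqb pmeqb_refl pmeqb_sym pmeqb_trans.

Definition model := {eq_quot pmeqb_equiv}.

End Models.

Section Semantics.
Variable S : signature.

Section OneDomain.
Variable W : Type.

Definition of_pre (M : premodel S W) : model S W := \pi_({eq_quot @pmeqb_equiv S W}) M.

Lemma of_preP M N : of_pre M = of_pre N <-> pmeq M N.
Proof. by split=> [/eqmodP/asboolP //|MN]; apply/eqmodP/asboolP. Qed.

Definition point (M : model S W) : W := ppt (repr M).

Definition valuation (M : model S W) : W -> set (Atom S) := pval (repr M).

Definition acc (M : model S W) (m : modality S) (v : W) : set (model S W) :=
  range (fun i : pix (repr M) m v => of_pre (pnx (repr M) i)).

Lemma pmeq_repr (M : premodel S W) : pmeq (repr (of_pre M)) M.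
Proof. by apply/of_preP; rewrite /of_pre reprK. Qed.

Lemma point_of_pre (M : premodel S W) : point (of_pre M) = ppt M.
Proof. by have [] := pmeq_same (pmeq_repr M). Qed.

Lemma valuation_of_pre (M : premodel S W) : valuation (of_pre M) = pval M.
Proof. by apply/funext => v; have [_ e _ _] := pmeq_same (pmeq_repr M); exact: e. Qed.

Lemma acc_of_pre (M : premodel S W) m v :
  acc (of_pre M) m v = range (fun i : pix M m v => of_pre (pnx M i)).
Proof.
have [_ _ f b] := pmeq_same (pmeq_repr M).
apply/seteqP; split=> _ [i _ <-].
- by have [j /of_preP ->] := f m v i; exists j.
- by have [j /of_preP <-] := b m v i; exists j.
Qed.

Lemma model_coind (Z : model S W -> model S W -> Prop) :
  (forall M M', Z M M' ->
    [/\ point M = point M', valuation M = valuation M',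
        (forall m v N, acc M m v N -> exists2 N', acc M' m v N' & Z N N')
      & (forall m v N', acc M' m v N' -> exists2 N, acc M m v N & Z N N')]) ->
  forall M M', Z M M' -> M = M'.
Proof.
move=> HZ M M' ZM; rewrite -[M]reprK -[M']reprK; apply/of_preP.
exists (fun X Y => Z (of_pre X) (of_pre Y)); last by rewrite /of_pre !reprK.
move=> {ZM}M {}M' /HZ[]; rewrite !point_of_pre !valuation_of_pre => e1 e2 f b.
split=> // [v|m v i|m v i]; first by rewrite e2.
- case: (f m v (of_pre (pnx M i))); rewrite acc_of_pre; first by exists i.
  by move=> _ [j _ <-]; exists j.
- case: (b m v (of_pre (pnx M' i))); rewrite acc_of_pre; first by exists i.
  by move=> _ [j _ <-]; exists j.
Qed.

(* Every tuple <w, W, V, R>, with each R(m, v) a small set of models, is the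
   tuple of components of a model. *)
Definition mk_model (w : W) (V : W -> set (Atom S))
    (I : modality S -> W -> Type) (F : forall m v, I m v -> model S W) :
    model S W :=
  of_pre (@PreModel S W w V I (fun m v i => repr (F m v i))).

Lemma mk_modelE w V I F (M := @mk_model w V I F) :
  [/\ point M = w, valuation M = V & forall m v, acc M m v = range (F m v)].
Proof.
rewrite /M point_of_pre valuation_of_pre; split=> // m v; rewrite acc_of_pre /=.
by congr image; apply/funext => i; rewrite /of_pre reprK.
Qed.

Inductive Ext (M : model S W) : set (model S W) :=
| Ext_refl : Ext M M
| Ext_step N m v N' : Ext M N -> acc N m v N' -> Ext M N'.

Definition sat_lit (M : model S W) (l : lit S) : Prop :=
  match l with
  | Pos a => valuation M (point M) a
  | Neg a => ~ valuation M (point M) a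
  end.

Fixpoint sat_mlit (M : model S W) (x : mlit S) {struct x} : Prop :=
  match x with
  | Lit l => sat_lit M l
  | Box m C => forall N, acc M m (point M) N -> hasProp (sat_mlit N) C
  | NBox m C => ~ (forall N, acc M m (point M) N -> hasProp (sat_mlit N) C)
  end.

Definition sat_clause (M : model S W) (C : clause S) : Prop :=
  hasProp (sat_mlit M) C.

Definition sat (M : model S W) (phi : formula S) : Prop :=
  allProp (sat_clause M) phi.

(* The path (M, m_1, M_1, ..., m_k, M_k) rooted at M is represented by the list
   of the pairs (m_i, M_i). *)
Fixpoint is_path (M : model S W) (p : seq (modality S * model S W)) : Prop :=
  match p with
  | [::] => True
  | (m, N) :: p' => acc M m (point M) N /\ is_path N p'
  end.

Definition paths (M : model S W) : set (seq (modality S * model S W)) :=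
  [set p | is_path M p].

Definition path_last (M : model S W) (p : seq (modality S * model S W)) :
    model S W :=
  last M (unzip2 p).

Definition tree (M : model S W) : Prop :=
  set_bij (paths M) (Ext M) (path_last M).

Definition L_of (A : set (Atom S)) : set (lit S) :=
  [set Pos a | a in A] `|` [set Neg a | a in ~` A].

(* R'(m, v) is taken from R at the inverse image of m, so that M and its image
   satisfy corresponding formulas: the edges labelled m in M become the edges
   labelled [act_mod s m] in the image, just as an atom a true in M becomes the
   literal [s a]. This agrees with taking R at [act_mod s m] when the
   permutations are involutive on indices or fix all modalities, but not for,
   say, a 3-cycle of indices. *)
CoFixpoint app_pre (ss : perm_seq S) (M : premodel S W) : premodel S W :=
  @PreModel S W
    (ppt M)
    (fun v => [set a | (phead ss @` L_of (pval M v)) (Pos a)])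
    (fun m v => pix M (act_mod (lperm_inv (phead ss)) m) v)
    (fun m v i => app_pre (behead ss) (pnx M i)).

Definition app_model (ss : perm_seq S) (M : model S W) : model S W :=
  of_pre (app_pre ss (repr M)).

Lemma app_pre_pmeq ss M N : pmeq M N -> pmeq (app_pre ss M) (app_pre ss N).
Proof.
move=> MN; exists (fun X Y => exists ss' X' Y',
  [/\ pmeq X' Y', X = app_pre ss' X' & Y = app_pre ss' Y']); last first.
  by exists ss, M, N.
move=> _ _ [ss' [X [Y [/pmeq_same[e1 e2 f b] -> ->]]]]; split=> //=.
- by move=> v; rewrite e2.
- move=> m v i; have [j XY] := f _ _ i; exists j.
  by exists (behead ss'), (pnx X i), (pnx Y j).
- move=> m v i; have [j XY] := b _ _ i; exists j.
  by exists (behead ss'), (pnx X j), (pnx Y i).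
Qed.

Lemma app_modelE ss (M : model S W) :
  [/\ point (app_model ss M) = point M,
      (forall v, valuation (app_model ss M) v =
         [set a | (phead ss @` L_of (valuation M v)) (Pos a)])
    & (forall m v, acc (app_model ss M) m v =
         app_model (behead ss) @` acc M (act_mod (lperm_inv (phead ss)) m) v)].
Proof.
rewrite /app_model point_of_pre valuation_of_pre; split=> // m v; rewrite acc_of_pre /=.
have E i : of_pre (app_pre (behead ss) (pnx (repr M) i)) =
    app_model (behead ss)
      (of_pre (@pnx _ _ (repr M) (act_mod (lperm_inv (phead ss)) m) v i)).
  by apply/of_preP/app_pre_pmeq/pmeq_sym/pmeq_repr.
apply/seteqP; split=> [_ [i _ <-]|_ [_ [i _ <-] <-]].
- by rewrite E; eexists; [exists i | ].
- by exists i => //; rewrite E.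
Qed.

End OneDomain.

Definition bisimulation (W W' : Type) (M : model S W) (M' : model S W')
    (Z : model S W -> model S W' -> Prop) : Prop :=
  (forall N N', Z N N' -> Ext M N /\ Ext M' N') /\
  (forall N N', Z N N' ->
    [/\ (forall a, valuation N (point N) a <-> valuation N' (point N') a),
        (forall m X, acc N m (point N) X ->
           exists2 X', acc N' m (point N') X' & Z X X')
      & (forall m X', acc N' m (point N') X' ->
           exists2 X, acc N m (point N) X & Z X X')]).

Definition bisimilar (W W' : Type) (M : model S W) (M' : model S W') : Prop :=
  exists2 Z, bisimulation M M' Z & Z M M'.

(* The domain W is nonempty as soon as there is a model over it. *)
Definition model_class := forall W : Type, set (model S W).

Definition Mod_in (C : model_class) (phi : formula S) : model_class :=
  fun W => [set M | C W M /\ sat M phi].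

Definition entails (C : model_class) (phi psi : formula S) : Prop :=
  forall W : Type, @Mod_in C phi W `<=` @Mod_in C psi W.

Definition C_Tree : model_class := fun W => [set M | tree M].

Definition interC (C D : model_class) : model_class := fun W => C W `&` D W.

Definition closed_accessibility (C : model_class) : Prop :=
  forall (W : Type) (M : model S W), C W M -> Ext M `<=` C W.

Definition closed_trees (C : model_class) : Prop :=
  forall (W : Type) (M : model S W), C W M ->
  exists (W' : Type) (T : model S W'), [/\ tree T, C W' T & bisimilar M T].

Definition closed_under (ss : perm_seq S) (D : model_class) : Prop :=
  forall (W : Type) (M : model S W), D W M -> D W (app_model ss M).

End Semantics.

Arguments Mod_in {S} C phi W _.
Arguments C_Tree {S} W _.
Arguments interC {S} C D W _.

(* Main.v *)
From HB Require Import structures.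
From mathcomp Require Import all_boot.
From mathcomp Require Import boolp classical_sets functions cardinality.
From Stdlib Require List.
Require Import Defs.

(** The layered action transports satisfaction: [M] satisfies [chi] iff
    [app_model ss M] satisfies [app_formula ss chi]. By bisimilarity it suffices
    to look at tree models of the class, which are closed under the action. If [T]
    is a tree model of [phi], so is its image, because [ss] is a symmetry; hence
    entailment of the image of [psi] gives entailment of [psi]. Conversely one
    needs a preimage of [T] inside the class, which is only assumed closed under
    [ss] and not under its inverse. But permutations moving finitely many
    literals have finite order, so some iterate of the action fixes [T], and the
    iterate just before it is the required preimage. *)

Set Implicit Arguments.
Unset Strict Implicit.
Unset Printing Implicit Defensive.

Local Open Scope classical_set_scope.

(** * Periods of iterated maps *)

Lemma iter_period_mul T (f : T -> T) n k x :
  iter n f x = x -> iter (k * n) f x = x.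
Proof. by move=> fx; elim: k => [//|k IH]; rewrite mulSn iterD IH. Qed.

Lemma iter_fixpoint T (f : T -> T) n x : f x = x -> iter n f x = x.
Proof. by move=> fx; rewrite -[n]muln1; exact: iter_period_mul. Qed.

Lemma iter_inv_period T (f g : T -> T) n :
  cancel g f -> (forall x, iter n f x = x) -> forall x, iter n g x = x.
Proof.
move=> gK fn x; rewrite -[LHS]fn.
by elim: n {fn} x => [//|n IH] x; rewrite iterSr iterS gK IH.
Qed.

(** Pigeonhole: the first [(size s).+1] iterates cannot be distinct inside [s], and injectivity
    cancels the common iterations of two that coincide. *)
Lemma injective_periodic (T : eqType) (f : T -> T) (s : seq T) (x : T) :
  injective f -> (forall k, iter k f x \in s) ->
  exists2 n, 0 < n & iter n f x = x.
Proof.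
move=> injf fs; apply: contrapT => noper.
have injk k : injective (iter k f) by elim: k => [|k IH] a b //= /injf/IH.
have neq i j : i < j -> iter i f x <> iter j f x.
  move=> ij e; apply: noper; exists (j - i); first by rewrite subn_gt0.
  by apply: (injk i); rewrite -iterD subnKC // ltnW.
have /uniq_leq_size : uniq [seq iter k f x | k <- iota 0 (size s).+1].
  rewrite map_inj_in_uniq ?iota_uniq // => i j _ _.
  by case: (ltngtP i j) => // ij; [move/(neq _ _ ij) | move/esym/(neq _ _ ij)].
move=> /(_ s); rewrite size_map size_iota ltnn => H.
by have /H : {subset [seq iter k f x | k <- iota 0 (size s).+1] <= s}
  by move=> _ /mapP[k _ ->].
Qed.

(** * Finite order of finitely supported permutations *)

Section FiniteOrder.
Variable S : signature.

HB.instance Definition _ := gen_eqMixin (lit S).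

Definition has_period (n : nat) (s : lperm S) : Prop :=
  forall l, iter n s l = l.

Lemma has_periodMl k n (s : lperm S) : has_period n s -> has_period (k * n) s.
Proof. by move=> sn l; exact: iter_period_mul. Qed.

Lemma lperm_orbit_finite (s : lperm S) l : exists2 n, 0 < n & iter n s l = l.
Proof.
have [t supp] := (finite_seqP _).1 (lperm_finite s).
have injs : injective s := can_inj (@lperm_funK _ s).
apply: (@injective_periodic _ _ (l :: t)) => // k; rewrite inE.
have [//|kl /=] := eqVneq (iter k s l) l.
(* An iterate fixed by [s] must be [l] itself, by injectivity, so the orbit stays in [l] together
   with the support. *)
have : [set l | s l <> l] (iter k s l).
  move=> fixk; move/eqP: kl; apply.
  elim: k fixk => [//|k IH] /= /injs fixk; rewrite fixk; exact: IH.
by rewrite supp.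
Qed.

(** Multiplying the periods of the finitely many moved literals gives a uniform period; the other
    literals are fixed. *)
Lemma lperm_period (s : lperm S) : exists2 n, 0 < n & has_period n s.
Proof.
have [t supp] := (finite_seqP _).1 (lperm_finite s).
suff [n n0 nt] : exists2 n, 0 < n & forall l, l \in t -> iter n s l = l.
  exists n => // l; have [sl|sl] := pselect (s l = l); first exact: iter_fixpoint.
  by apply: nt; have : [set l | s l <> l] l by []; rewrite supp.
elim: t {supp} => [|l t [n n0 IH]]; first by exists 1.
have [m m0 ml] := lperm_orbit_finite s l.
exists (m * n) => [|k]; first by rewrite muln_gt0 m0.
rewrite inE => /orP[/eqP->|/IH]; last exact: iter_period_mul.
by rewrite mulnC; exact: iter_period_mul.
Qed.

Lemma perm_seq_period (ss : perm_seq S) :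
  exists2 n, 0 < n & List.Forall (has_period n) ss.
Proof.
elim: ss => [|s ss [n n0 IH]]; first by exists 1.
have [m m0 ms] := lperm_period s.
exists (m * n); first by rewrite muln_gt0 m0.
constructor; first by rewrite mulnC; exact: has_periodMl.
by apply: List.Forall_impl IH => r; exact: has_periodMl.
Qed.

End FiniteOrder.

(** * Nested induction, set equality of lists, and the action on modalities *)

Section Syntax.
Variable S : signature.

(** The induction hypothesis must reach the members of the clause under a modality, hence an inner
    induction on the list within the outer fixpoint. *)
Lemma mlit_nested_ind (P : mlit S -> Prop) :
  (forall l, P (Lit l)) ->
  (forall m C, (forall x, List.In x C -> P x) -> P (Box m C)) ->
  (forall m C, (forall x, List.In x C -> P x) -> P (NBox m C)) ->
  forall x, P x.
Proof.
move=> Plit Pbox Pnbox; fix IH 1.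
case=> [l|m C|m C]; [exact: Plit | apply: Pbox | apply: Pnbox];
(elim: C => [x []|y C IHC x [<-|]]; [exact: IH | exact: IHC]).
Qed.

Lemma eq_hasProp T (P Q : T -> Prop) s :
  (forall x, List.In x s -> P x <-> Q x) -> hasProp P s <-> hasProp Q s.
Proof.
by move=> PQ; rewrite !hasPropP; split=> -[x xs /(PQ _ xs)]; exists x.
Qed.

Lemma hasProp_map T U (f : T -> U) (P : U -> Prop) s :
  hasProp P (map f s) <-> hasProp (P \o f) s.
Proof. by elim: s => //= x s ->. Qed.

Lemma allProp_map T U (f : T -> U) (P : U -> Prop) s :
  allProp P (map f s) <-> allProp (P \o f) s.
Proof. by elim: s => //= x s ->. Qed.

(** Compatibility is asked only at members of [s], which is all that the nested induction hypothesis
    provides. *)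
Lemma set_eq_by_hasProp T (r : T -> T -> Prop) (P : T -> Prop) s t :
  (forall x, List.In x s -> forall y, r x y -> (P x <-> P y)) ->
  set_eq_by r s t -> hasProp P s <-> hasProp P t.
Proof.
move=> rP [/allPropP st /allPropP ts]; rewrite !hasPropP; split=> -[x xs Px].
- by have /hasPropP[y yt /rP-/(_ xs) xy] := st _ xs; exists y => //; apply/xy.
- by have /hasPropP[y yt /rP-/(_ yt) xy] := ts _ xs; exists y => //; apply/xy.
Qed.

Lemma set_eq_by_allProp T (r : T -> T -> Prop) (P : T -> Prop) s t :
  (forall x y, r x y -> (P x <-> P y)) ->
  set_eq_by r s t -> allProp P s <-> allProp P t.
Proof.
move=> rP [/allPropP st /allPropP ts]; rewrite !allPropP; split=> H x xs.
- by have /hasPropP[y yt /rP xy] := ts _ xs; apply/xy/H.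
- by have /hasPropP[y yt /rP xy] := st _ xs; apply/xy/H.
Qed.

Lemma consistent_phead (ss : perm_seq S) :
  consistent_seq ss -> consistent (phead ss).
Proof. by case=> [|s ss'] //= []. Qed.

Lemma Forall_behead T (P : T -> Prop) s :
  List.Forall P s -> List.Forall P (behead s).
Proof. by case. Qed.

Lemma has_period_phead n (ss : perm_seq S) :
  List.Forall (has_period n) ss -> has_period n (phead ss).
Proof. by case=> [l|s ss' sn _ //]; exact: iter_fixpoint. Qed.

Lemma consistent_inv (s : lperm S) l :
  consistent s -> lperm_inv s (negl l) = negl (lperm_inv s l).
Proof.
by move=> cs; rewrite -{1}[l](lperm_invK s) -cs lperm_funK.
Qed.

(** The inner action forgets the sign of [g (Pos a)]; as [f] commutes with negation, the atom
    underlying its value is independent of that sign. *)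
Lemma act_mod_comp (f g : lit S -> lit S) m :
  (forall l, f (negl l) = negl (f l)) ->
  act_mod f (act_mod g m) = act_mod (f \o g) m.
Proof.
move=> cf; case: m => //= k a; congr At.
by case: (g (Pos a)) => //= b; rewrite -[Neg b]/(negl (Pos b)) cf; case: (f _).
Qed.

Lemma act_mod_id (f : lit S -> lit S) m : f =1 id -> act_mod f m = m.
Proof. by move=> fE; case: m => //= k a; rewrite fE. Qed.

Lemma act_modK (s : lperm S) m : consistent s ->
  act_mod (lperm_inv s) (act_mod s m) = m.
Proof.
move=> cs; rewrite act_mod_comp => [|l]; last exact: consistent_inv.
by apply: act_mod_id => l /=; rewrite lperm_funK.
Qed.

Lemma act_mod_iter (f : lit S -> lit S) k m :
  (forall l, f (negl l) = negl (f l)) ->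
  iter k (act_mod f) m = act_mod (iter k f) m.
Proof.
move=> cf; elim: k => [|k IH] /=; first by rewrite act_mod_id.
by rewrite IH act_mod_comp.
Qed.

End Syntax.

(** * The layered action on models and its effect on satisfaction *)

Section Semantics.
Variables (S : signature) (W : Type).
Implicit Types (M N X Y : model S W) (ss : perm_seq S).

Lemma L_of_negl (A : set (Atom S)) l : L_of A (negl l) <-> ~ L_of A l.
Proof.
case: l => a /=; split.
- by move=> [[b _ //]|[b nb [<-]]] [[c Ac [ca]]|[c _ //]]; apply: nb; rewrite -ca.
- by move=> nA; right; exists a => // Aa; apply: nA; left; exists a.
- by move=> [[b Ab [<-]]|[b _ //]] [[c _ //]|[c nA [ca]]]; apply: nA; rewrite ca.
- move=> nA; left; exists a => //; apply: contrapT => nAa.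
  by apply: nA; right; exists a.
Qed.

Lemma L_of_Pos (A : set (Atom S)) a : L_of A (Pos a) <-> A a.
Proof. by split=> [[[b Ab [<-]]|[b _]]|Aa] //; left; exists a. Qed.

Lemma sat_litE M l : sat_lit M l <-> L_of (valuation M (point M)) l.
Proof.
case: l => a; first by rewrite L_of_Pos.
by rewrite -[Neg a]/(negl (Pos a)) L_of_negl L_of_Pos.
Qed.

(** The new valuation records only the positive literals of the permuted set. Consistency recovers
    the negative ones, since exactly one literal of each complementary pair belongs to [L_of A]. *)
Lemma L_of_app_model ss M v l : consistent_seq ss ->
  L_of (valuation (app_model ss M) v) l <->
  L_of (valuation M v) (lperm_inv (phead ss) l).
Proof.
move=> /consistent_phead cs; have [_ -> _] := app_modelE ss M.
have posE a : L_of [set a | (phead ss @` L_of (valuation M v)) (Pos a)] (Pos a) <->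
    L_of (valuation M v) (lperm_inv (phead ss) (Pos a)).
  rewrite L_of_Pos /=; split=> [[l' ? <-]|?]; first by rewrite lperm_funK.
  by exists (lperm_inv (phead ss) (Pos a)); rewrite ?lperm_invK.
case: l => a; first exact: posE.
by rewrite -[Neg a]/(negl (Pos a)) consistent_inv // !L_of_negl posE.
Qed.

Lemma point_iter_app_model k ss M : point (iter k (app_model ss) M) = point M.
Proof.
by elim: k => //= k IH; have [-> _ _] := app_modelE ss (iter k (app_model ss) M).
Qed.

Lemma L_of_iter_app_model k ss M v l : consistent_seq ss ->
  L_of (valuation (iter k (app_model ss) M) v) l <->
  L_of (valuation M v) (iter k (lperm_inv (phead ss)) l).
Proof.
by move=> cs; elim: k l => [//|k IH] l; rewrite iterS iterSr L_of_app_model.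
Qed.

Lemma acc_iter_app_model k ss M m v :
  acc (iter k (app_model ss) M) m v =
  iter k (app_model (behead ss)) @`
    acc M (iter k (act_mod (lperm_inv (phead ss))) m) v.
Proof.
elim: k m => [|k IH] m; first by rewrite image_id.
rewrite [iter k.+1 (act_mod _) m]iterSr /=.
have [_ _ ->] := app_modelE ss (iter k (app_model ss) M).
by rewrite IH image_comp.
Qed.

(** By coinduction. The relation [Z] ranges over all sequences of period [n], because passing to a
    successor drops the head of the sequence. *)
Lemma iter_app_model_period n ss M :
  consistent_seq ss -> List.Forall (has_period n) ss ->
  iter n (app_model ss) M = M.
Proof.
move=> cs ns; pose Z (X Y : model S W) := exists ss', [/\ consistent_seq ss',
  List.Forall (has_period n) ss' & X = iter n (app_model ss') Y].
apply: (@model_coind _ _ Z); last by exists ss.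
move=> {cs ns M}_ M [ss' [cs ns ->]].
have invn l : iter n (lperm_inv (phead ss')) l = l.
  by apply: iter_inv_period (has_period_phead ns) l; exact: lperm_invK.
have accE m v : acc (iter n (app_model ss') M) m v =
    iter n (app_model (behead ss')) @` acc M m v.
  rewrite acc_iter_app_model act_mod_iter ?act_mod_id // => l.
  exact/consistent_inv/consistent_phead.
have Zb N : Z (iter n (app_model (behead ss')) N) N.
  by exists (behead ss'); split=> //; exact: Forall_behead.
split; first exact: point_iter_app_model.
- apply/funext => v; apply/seteqP; split=> a;
  by rewrite -!L_of_Pos L_of_iter_app_model // invn.
- by move=> m v N; rewrite accE => -[N' MN' <-]; exists N'.
- move=> m v N MN; exists (iter n (app_model (behead ss')) N) => //.
  by rewrite accE; exists N.
Qed.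

(** All heads of the empty sequence are the identity, so 1 is a period. *)
Lemma app_model_nil M : app_model [::] M = M.
Proof. by apply: (@iter_app_model_period 1) => //; constructor. Qed.

Lemma sat_app_mlit x ss M : consistent_seq ss ->
  sat_mlit (app_model ss M) (app_mlit ss x) <-> sat_mlit M x.
Proof.
(* Common core of both modal cases: by [act_modK], the edges of the image labelled with the permuted
   [m] come from the edges of [N] labelled [m], and the tail acts on their targets. *)
have box m C ss' N : (forall x, List.In x C -> forall ss N, consistent_seq ss ->
      sat_mlit (app_model ss N) (app_mlit ss x) <-> sat_mlit N x) ->
    consistent_seq ss' ->
    (forall X, acc (app_model ss' N) (act_mod (phead ss') m)
        (point (app_model ss' N)) X ->
      hasProp (sat_mlit X) (map (app_mlit (behead ss')) C)) <->
    (forall X, acc N m (point N) X -> hasProp (sat_mlit X) C).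
  move=> IH cs; have [-> _ ->] := app_modelE ss' N.
  rewrite act_modK; last exact: consistent_phead.
  have step X : hasProp (sat_mlit (app_model (behead ss') X))
      (map (app_mlit (behead ss')) C) <-> hasProp (sat_mlit X) C.
    rewrite hasProp_map; apply: eq_hasProp => y yC.
    exact: IH yC _ _ (Forall_behead cs).
  split=> H X; first by move=> NX; apply/step/H; exists X.
  by move=> [Y NY <-]; apply/step/H.
elim/mlit_nested_ind: x ss M => [l|m C IH|m C IH] [|s ss] M cs;
  rewrite ?app_model_nil //=.
- rewrite !sat_litE L_of_app_model //=.
  by have [-> _ _] := app_modelE (s :: ss) M; rewrite lperm_funK.
- exact: (box m C (s :: ss)).
- exact/not_iff_compat/(box m C (s :: ss)).
Qed.

Lemma sat_app_formula (chi : formula S) ss M : consistent_seq ss ->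
  sat (app_model ss M) (app_formula ss chi) <-> sat M chi.
Proof.
move=> cs; rewrite /sat allProp_map; elim: chi => //= C chi ->.
rewrite /sat_clause hasProp_map.
by rewrite (eq_hasProp (Q := sat_mlit M)) // => x _; exact: sat_app_mlit.
Qed.

Lemma mlit_eq_sat x y M : mlit_eq x y -> sat_mlit M x <-> sat_mlit M y.
Proof.
elim/mlit_nested_ind: x y M => [l|m C IH|m C IH] [l'|m' C'|m' C'] M //=.
- by move=> ->.
- move=> [-> CC']; have E N := set_eq_by_hasProp (P := sat_mlit N) _ CC'.
  by split=> H N /H /E; apply=> x xC y xy; exact: IH.
- move=> [-> CC']; have E N := set_eq_by_hasProp (P := sat_mlit N) _ CC'.
  apply: not_iff_compat.
  by split=> H N /H /E; apply=> x xC y xy; exact: IH.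
Qed.

Lemma formula_eq_sat (chi1 chi2 : formula S) M :
  formula_eq chi1 chi2 -> sat M chi1 <-> sat M chi2.
Proof.
apply: set_eq_by_allProp => C D; apply: set_eq_by_hasProp => x _ y.
exact: mlit_eq_sat.
Qed.

Lemma symmetry_sat ss (phi : formula S) M :
  consistent_seq ss -> is_symmetry ss phi ->
  sat (app_model ss M) phi <-> sat M phi.
Proof.
by move=> cs /formula_eq_sat sym; rewrite -sym sat_app_formula.
Qed.

End Semantics.

(** * Bisimulation invariance and the two entailments *)

Lemma bisimilar_sat (S : signature) (W W' : Type) (M : model S W)
    (M' : model S W') (chi : formula S) :
  bisimilar M M' -> sat M chi <-> sat M' chi.
Proof.
case=> Z [_ HZ] ZMM'.
have H x : forall N N', Z N N' -> sat_mlit N x <-> sat_mlit N' x.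
  elim/mlit_nested_ind: x => [[a|a]|m C IH|m C IH] N N' /HZ[val forth back] /=.
  - exact: val.
  - exact/not_iff_compat/val.
  - split=> H X => [/back|/forth] [Y /H HY ZY]; move: HY.
    + by apply: (eq_hasProp _).1 => x xC; exact: IH.
    + by apply: (eq_hasProp _).1 => x xC; apply: iff_sym; exact: IH.
  - apply: not_iff_compat; split=> H X => [/back|/forth] [Y /H HY ZY]; move: HY.
    + by apply: (eq_hasProp _).1 => x xC; exact: IH.
    + by apply: (eq_hasProp _).1 => x xC; apply: iff_sym; exact: IH.
elim: chi => //= C chi IH; rewrite /sat /= -/(sat M chi) -/(sat M' chi) IH.
by rewrite /sat_clause (eq_hasProp (Q := sat_mlit M')) // => x _; exact: H.
Qed.

Theorem theorem3 (S : signature) (phi : formula S) (ss : perm_seq S)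
    (C : model_class S)
    (Hcons : consistent_seq ss)
    (Hacc : closed_accessibility C)
    (Htree : closed_trees C)
    (Hclosed : closed_under ss (interC C C_Tree))
    (Hsym : is_symmetry ss phi) :
  forall psi : formula S,
    entails C phi psi <-> entails C phi (app_formula ss psi).
Proof.
move=> psi; split=> ent W M [CM Mphi]; split=> //;
  have [W' [T [treeT CT bis]]] := Htree _ _ CM;
  apply/(bisimilar_sat _ bis); have Tphi := (bisimilar_sat _ bis).1 Mphi.
(* The period is positive, hence of the form [n.+1]: [T] is the image of its [n]-th iterate, which
   lies in the class and satisfies [phi]. *)
- have [[//|n] _ per] := perm_seq_period ss.
  have /= <- := iter_app_model_period T Hcons per.
  apply/sat_app_formula => //.
  have iterC k : interC C C_Tree W' (iter k (app_model ss) T).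
    by elim: k => [//|k IH]; exact: Hclosed.
  have iterphi k : sat (iter k (app_model ss) T) phi.
    by elim: k => [//|k IH]; apply/symmetry_sat.
  by apply: (ent _ _ (conj _ (iterphi n))).2; case: (iterC n).
(* Here the hypothesis is applied directly to the image of [T]. *)
- have [CsT _] := Hclosed _ _ (conj CT treeT).
  apply/(sat_app_formula _ _ Hcons).
  by apply: (ent _ _ (conj CsT _)).2; apply/symmetry_sat.
Qed.
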